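(* Consider the closed chain of $N$ contours with $2m$ cells and a cluster of $l<2m$ particles on each contour (dynamics in the context). (a) If $l\le m$, then there exist no states of collapse. (b) If $l>m$, then from any admissible initial state the system results in a state of collapse, i.e. there is a time $t_0$ such that at every time $t\ge t_0$ no cluster moves.
   Context: Closed chain of contours. Integers $N\ge 2$, $m\ge 1$, $1\le l<2m$. Contours are indexed by $i\in\mathbb{Z}/N$ (arithmetic of contour indices is modulo $N$); each contour has $2m$ cells indexed $0,1,\dots,2m-1$ in the direction of movement (arithmetic of cells is modulo $2m$) and one cluster of $l$ particles in consecutive cells. The state $x_i(t)\in\{0,\dots,2m-1\}$ of contour $i$ at time $t$ is the cell of the leading particle of its cluster (cluster $i$); the system state is $(x_0(t),\dots,x_{N-1}(t))$. Contours $i$ and $i+1$ share the node $(i,i+1)$, located between cells $0,1$ of contour $i$ and between cells $m,m+1$ of contour $i+1$. Cluster $i$ occupies node $(i,i+1)$ if $x_i\in\{1,\dots,l-1\}$; cluster $i$ occupies node $(i-1,i)$ if $x_i\in\{m+1,\dots,m+l-1\}$ modulo $2m$. A state is admissible if no node is occupied by two clusters; only admissible states are considered. Cluster $i$ is at node $(i,i+1)$ if $x_i=0$, and at node $(i-1,i)$ if $x_i=m$. Dynamics ($t\to t+1$, all clusters simultaneously): $x_i(t+1)=x_i(t)+1 \bmod 2m$ unless cluster $i$ is delayed at time $t$, in which case $x_i(t+1)=x_i(t)$. Cluster $i$ is delayed at time $t$ iff either $x_i(t)=0$ and cluster $i+1$ occupies node $(i,i+1)$; or $x_i(t)=m$ and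 cluster $i-1$ occupies node $(i-1,i)$; or $x_i(t)=m$ and $x_{i-1}(t)=0$ (left-priority rule: when two clusters are at the same node simultaneously, the left one passes first). The system is in a state of collapse at time $t_0$ if no cluster moves at any time $t\ge t_0$. *)

(* Defs.v *)
From mathcomp Require Import all_boot.

Set Implicit Arguments.
Unset Strict Implicit.
Unset Printing Implicit Defensive.

(* Contours are indexed by 'I_N and cells by 'I_(2 * m); the cyclic successor
   and predecessor are [ordS] and [ord_pred].  The node (i, i+1), shared by the
   contours i and i+1, is designated by its left contour i. *)
Definition state (N m : nat) := {ffun 'I_N -> 'I_(2 * m)}.

Section Chain.

Variables (N m l : nat).
Implicit Types (x : state N m) (i : 'I_N) (t : nat).

(* Cluster i occupies node (i, i+1). *)
Definition occupies_right x i : bool := 1 <= x i <= l - 1.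

(* Cluster i occupies node (i-1, i): x_i is m+1, ..., m+l-1 modulo 2m. *)
Definition occupies_left x i : bool :=
  [exists k : 'I_l, (1 <= k) && (x i == (m + k) %% (2 * m) :> nat)].

(* Only clusters i and i+1 can occupy node (i, i+1). *)
Definition admissible x : bool :=
  [forall i, ~~ (occupies_right x i && occupies_left x (ordS i))].

Definition at_right x i : bool := x i == 0 :> nat.
Definition at_left x i : bool := x i == m :> nat.

(* The last disjunct is the left-priority rule. *)
Definition delayed x i : bool :=
  [|| at_right x i && occupies_left x (ordS i),
      at_left x i && occupies_right x (ord_pred i)
    | at_left x i && at_right x (ord_pred i)].

Definition step x : state N m :=
  [ffun i => if delayed x i then x i else ordS (x i)].

Definition state_at x t : state N m := iter t step x.

Definition moves_at x t i : Prop := state_at x t.+1 i <> state_at x t i.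

(* The system started from the state x at time 0 is in a state of collapse at
   time t0. *)
Definition collapse_at x t0 : Prop :=
  forall t, t0 <= t -> forall i, ~ moves_at x t i.

End Chain.

(* Main.v *)
Require Import Defs.
From mathcomp Require Import all_boot.
From mathcomp Require Import zify.

(** If [l <= m], a cluster standing at a node occupies no node, so a collapsed
    state could only be maintained by the left-priority rule; but that rule
    delays a cluster only behind a left neighbour that is itself free to move.
    If [l > m], every cluster occupies at least one of its two nodes, and
    admissibility then forces all clusters to occupy only their right node
    (cells [1..m]) or all of them only their left node (cells [m+1..2m]); each
    cluster advances to the last cell of that range and is blocked there by its
    neighbour. *)

(** The indices form a single cycle under [ordS]: [j] is reached from [i] in [j + n - i] steps,
    where the extra [n] keeps the truncated subtraction exact. *)
Lemma ordS_closed n (P : pred 'I_n) (i : 'I_n) :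
  P i -> (forall j, P j -> P (ordS j)) -> forall j, P j.
Proof.
move=> Pi PS j.
have iterP k : P (iter k (@ordS n) i) by elim: k => //= k; apply: PS.
have iterE k : iter k (@ordS n) i = (i + k) %% n :> nat.
  elim: k => [|k IHk] /=; first by rewrite addn0 modn_small.
  by rewrite IHk -addn1 modnDml addn1 addnS.
suff <- : iter (j + n - i) (@ordS n) i = j by [].
apply: val_inj; rewrite /= iterE.
have -> : i + (j + n - i) = j + n by have := ltn_ord i; lia.
by rewrite modnDr modn_small.
Qed.

Section Chain.

Variables (N m l : nat).
Hypothesis hm : 1 <= m.
Implicit Types (x : state N m) (i : 'I_N).

Lemma ordS_neq (c : 'I_(2 * m)) : ordS c <> c.
Proof.
move/(congr1 val) => /=; have := ltn_ord c.
have [eqc _|ne lt] := eqVneq c.+1 (2 * m); first by rewrite eqc modnn; lia.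
by rewrite modn_small; lia.
Qed.

Lemma stepE x i :
  step l x i =
  (if delayed l x i then x i : nat else if (x i).+1 == 2 * m then 0 else (x i).+1)
  :> nat.
Proof.
rewrite ffunE; case: ifP => //= _; case: eqP => [->|ne]; first exact: modnn.
by rewrite modn_small //; have := ltn_ord (x i); lia.
Qed.

(** The cell [m + k] wraps at most once; the second disjunct collects the wrapped values
    [m + k - 2 * m]. *)
Lemma occupies_leftE x i : l < 2 * m ->
  occupies_left l x i = (m < x i < m + l) || (x i + m < l).
Proof.
move=> hl; have xi := ltn_ord (x i).
apply/existsP/orP => [[k /andP[k1 /eqP xk]]|].
  have kl := ltn_ord k; have [lt|ge] := ltnP (m + k) (2 * m).
    by left; rewrite xk modn_small //; lia.
  right; have : x i = m + k - 2 * m :> nat; last by lia.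
  by rewrite xk -{1}(subnK ge) modnDr modn_small //; lia.
case=> [xl|xl].
  have kl : x i - m < l by lia.
  exists (Ordinal kl); rewrite /= subnKC ?modn_small ?eqxx ?andbT; lia.
have kl : x i + m < l by lia.
exists (Ordinal kl); rewrite /= addnCA addnn -mul2n modnDr modn_small //.
by rewrite eqxx; lia.
Qed.

Lemma fixed_collapse x t0 :
  step l (state_at l x t0) = state_at l x t0 -> collapse_at l x t0.
Proof.
move=> fix0 t t0t i; apply.
have atE : state_at l x t = state_at l x t0.
  rewrite /state_at -(subnK t0t) iterD; elim: (t - t0) => //= k ->.
  exact: fix0.
by rewrite /state_at /= -/(state_at l x t) atE fix0.
Qed.

Lemma collapse_delayed x t0 : collapse_at l x t0 ->
  forall i, delayed l (state_at l x t0) i.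
Proof.
move=> coll i; apply/negPn/negP => nd; apply: (coll t0 (leqnn t0) i).
by rewrite /moves_at /state_at /= ffunE -/(state_at l x t0) (negbTE nd); apply: ordS_neq.
Qed.

Lemma not_all_delayed x : 0 < N -> l <= m -> ~ forall i, delayed l x i.
Proof.
move=> hN hl all_d.
have x0m i : x i = 0 :> nat \/ x i = m :> nat.
  by case/or3P: (all_d i) => /andP[/eqP ? _]; auto.
have hl2 : l < 2 * m by lia.
have nright i : occupies_right l x i = false.
  by rewrite /occupies_right; case: (x0m i) => ->; lia.
have nleft i : occupies_left l x i = false.
  by rewrite occupies_leftE //; case: (x0m i) => ->; lia.
have priority i : at_left x i && at_right x (ord_pred i).
  by have := all_d i; rewrite /delayed nleft nright !andbF.
(* Priority at [i] puts its left neighbour at cell 0, and priority at that neighbour puts it at cell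
   [m]. *)
pose i := Ordinal hN.
have /andP[_ /eqP x0] := priority i.
have /andP[/eqP xm _] := priority (ord_pred i).
by lia.
Qed.

(** Here [d] bounds the steps still to be made; after [d] steps the bound is 0 and the state is
    fixed. *)
Lemma decreasing_collapse (P : nat -> state N m -> Prop) :
  (forall d x, P d x -> P d.-1 (step l x)) ->
  (forall x, P 0 x -> step l x = x) ->
  forall d x, P d x -> exists t0, collapse_at l x t0.
Proof.
move=> Pstep Pfix d x Px; exists d; apply/fixed_collapse/Pfix.
suff Piter k : P (d - k) (state_at l x k) by rewrite -(subnn d).
elim: k => [|k IHk]; first by rewrite subn0.
by rewrite subnS; apply: Pstep.
Qed.

Hypothesis hl : m < l < 2 * m.

Lemma collapse_right x : (forall i, 1 <= x i <= m) ->
  exists t0, collapse_at l x t0.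
Proof.
move=> xr.
pose P d x := forall i, (1 <= x i <= m) && (m - x i <= d).
(* No cluster is at cell 0, and since [m < l] every cell of [[1..m]] occupies the right node, so a
   cluster at [m] is always blocked. *)
have delE d y : P d y -> forall i, delayed l y i = (y i == m :> nat).
  move=> Py i; rewrite /delayed /at_right /at_left /occupies_right.
  by have := Py i; have := Py (ord_pred i); case: (occupies_left _ _ _); lia.
apply: (decreasing_collapse P _ _ m) => [d y Py i|y Py|i].
- by rewrite stepE (delE _ _ Py); have := Py i; do 2?case: ifP; lia.
- apply/ffunP => i; rewrite ffunE (delE _ _ Py).
  by have := Py i; case: eqP => //; lia.
- by have := xr i; lia.
Qed.

Lemma collapse_left x : (forall i, (x i == 0 :> nat) || (m < x i)) ->
  exists t0, collapse_at l x t0.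
Proof.
move=> xl.
(* Cell 0 is the end of the range, standing for [2 * m]. *)
pose P d x := forall i, (x i == 0 :> nat) || (m < x i) && (2 * m - x i <= d).
have delE d y : P d y -> forall i, delayed l y i = (y i == 0 :> nat).
  move=> Py i; rewrite /delayed occupies_leftE; last by lia.
  rewrite /at_right /at_left; have := ltn_ord (y (ordS i)).
  by have := Py i; have := Py (ordS i); case: (occupies_right _ _ _); lia.
apply: (decreasing_collapse P _ _ (2 * m)) => [d y Py i|y Py|i].
- rewrite stepE (delE _ _ Py); have := Py i; have := ltn_ord (y i).
  by do 2?case: ifP; lia.
- apply/ffunP => i; rewrite ffunE (delE _ _ Py).
  by have := Py i; have := ltn_ord (y i); case: eqP => //; lia.
- by have := xl i; lia.
Qed.

Lemma admissible_collapse x : admissible l x -> exists t0, collapse_at l x t0.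
Proof.
have hl2 : l < 2 * m by lia.
move=> /forallP adm.
have [/existsP[i0 r0]|/existsPn nr] := boolP [exists i, occupies_right l x i].
  have nleft i : occupies_right l x i -> ~~ occupies_left l x (ordS i).
    by move=> ri; have := adm i; rewrite ri.
  (* As [l > m], a cluster off its left node has its cell in [[l - m..m]], hence occupies its right
     node; this propagates around the chain. *)
  have right : forall i, occupies_right l x i.
    apply: ordS_closed r0 _ => j /nleft; rewrite occupies_leftE //.
    by rewrite /occupies_right; have := ltn_ord (x (ordS j)); lia.
  apply: collapse_right => i; have := nleft _ (right (ord_pred i)).
  rewrite ord_predK occupies_leftE //.
  by have := right i; rewrite /occupies_right; have := ltn_ord (x i); lia.
(* Off the right node, the cell is 0 or at least [l > m]. *)
apply: collapse_left => i; have := nr i.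
by rewrite /occupies_right; have := ltn_ord (x i); lia.
Qed.

End Chain.

Theorem theorem1 (N m l : nat) (hN : 2 <= N) (hm : 1 <= m)
    (hl1 : 1 <= l) (hl2 : l < 2 * m) :
  (l <= m ->
     forall x : state N m, admissible l x -> forall t0 : nat, ~ collapse_at l x t0)
  /\
  (m < l ->
     forall x : state N m, admissible l x -> exists t0 : nat, collapse_at l x t0).
Proof.
split=> [lm x _ t0 /(collapse_delayed _ _ _ hm)|ml x].
  by apply: not_all_delayed => //; lia.
by apply: admissible_collapse => //; rewrite ml.
Qed.
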